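(* Let $k\ge1$ and $N\ge0$ be integers. (i) If $\binom{n+k-1}{k}-1\le N\le \binom{n+k}{k}-1$ for some integer $n\ge0$, then $C_{N,k}=(N+1)n-\binom{n+k}{k+1}$. (ii) If $\binom{n+k-1}{k}\le N<\binom{n+k}{k}$ for some integer $n\ge1$, then $C_{N,k}-C_{N-1,k}=n$. (iii) If $\binom{n+k-1}{k}-1\le N<\binom{n+k}{k}-1$ for some integer $n\ge0$ and $\bm{a}=(a_1,\dots,a_k)\in P_{N,k}$, then $C_{N,k}=C(\bm{a})$ if and only if $\binom{n+i-2}{i}\le a_i\le\binom{n+i-1}{i}$ for every $i\in\{1,\dots,k\}$.
   Context: The $(N,k)$-growth game: there are $k$ subarrays $A_1,\dots,A_k$, initially empty, with $a_i$ items in $A_i$; all nonempty subarrays are full and the empty ones form a prefix. $N$ items are inserted one at a time: if some subarray is empty, the last empty subarray $A_i$ (largest $i$ with $a_i=0$) becomes a subarray containing just the new item, cost $1$; otherwise the player chooses $i\in\{1,\dots,k\}$, and $A_1,\dots,A_i$ together with the new item are merged into a new $A_i$ with $a_i\leftarrow 1+\sum_{j=1}^i a_j$, while $A_1,\dots,A_{i-1}$ become empty; cost $1+\sum_{j=1}^i a_j$. $C_{N,k}$ is the minimum total cost of inserting $N$ items. $P_{N,k}=\{(a_1,\dots,a_k)\in\mathbb{N}^k: \sum_i a_i=N,\ a_i=0\Rightarrow a_{i-1}=0 \text{ for } i=2,\dots,k\}$, and for $\bm{a}\in P_{N,k}$, $C(\bm{a})$ is the minimum total cost of reaching state $\bm{a}$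 from $(0,\dots,0)$; $C_{N,k}=\min_{\bm{a}\in P_{N,k}}C(\bm{a})$. Binomial coefficients satisfy $\binom{m}{j}=0$ for $0\le m<j$.
   Formalization: In (iii), as the game is stated some a in P_{N,k} cannot be reached (k=2, N=3, a=(1,2)), so C(a) is undefined; (iii) is proved for all reachable a, and also for every a in P_{N,k} with C(a) taken in the game where merges are allowed while some subarrays are still empty. *)

(* Defs.v *)
From mathcomp Require Import all_boot all_order all_algebra.

Set Implicit Arguments.
Unset Strict Implicit.
Unset Printing Implicit Defensive.

(* Subarrays are indexed from 0: [a i] is the size a_(i+1) of A_(i+1). *)
Definition state (k : nat) := {ffun 'I_k -> nat}.

Definition empty_state (k : nat) : state k := [ffun => 0].

(* [a] belongs to P_(N,k). *)
Definition in_P (N k : nat) (a : state k) : Prop :=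
  \sum_i a i = N /\ (forall i j : 'I_k, j = i.+1 :> nat -> a j = 0 -> a i = 0).

(* Merge A_1, ..., A_(i+1) and the new item into a new A_(i+1).  When A_(i+1)
   is the last empty subarray, everything before it is empty too (the empty
   subarrays form a prefix), so this puts the new item alone into A_(i+1). *)
Definition merge (k : nat) (a : state k) (i : 'I_k) : state k :=
  [ffun j : 'I_k => if j < i then 0
                    else if j == i then 1 + \sum_(l < k | l <= i) a l
                    else a j].

Definition last_empty (k : nat) (a : state k) (i : 'I_k) : bool :=
  (a i == 0) && [forall j : 'I_k, (i < j) ==> (a j != 0)].

(* A rule tells which indices may be used for the next insertion. *)
Definition rule (k : nat) := state k -> pred 'I_k.

(* The rule of the growth game: the last empty subarray must be used if there
   is one, otherwise the choice is free. *)
Definition game_rule (k : nat) : rule k := fun a i =>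
  if [exists j, a j == 0] then last_empty a i else true.

(* The same game, except that a merge is also allowed while some subarrays are
   still empty, as long as the empty subarrays form a prefix afterwards. *)
Definition early_merge_rule (k : nat) : rule k := fun a i =>
  [forall j : 'I_k, (i < j) ==> (a j != 0)].

(* A play is the sequence of the indices used by the successive insertions. *)
Fixpoint legal_from (k : nat) (r : rule k) (a : state k) (p : seq 'I_k) : bool :=
  if p is i :: q then r a i && legal_from r (merge a i) q else true.

Fixpoint cost_from (k : nat) (a : state k) (p : seq 'I_k) : nat :=
  if p is i :: q then merge a i i + cost_from (merge a i) q else 0.

Definition legal (k : nat) (r : rule k) (p : seq 'I_k) : bool :=
  legal_from r (empty_state k) p.

Definition cost (k : nat) (p : seq 'I_k) : nat := cost_from (empty_state k) p.

Definition final (k : nat) (p : seq 'I_k) : state k :=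
  foldl (@merge k) (empty_state k) p.

Definition reachable (k : nat) (r : rule k) (a : state k) : Prop :=
  exists p : seq 'I_k, legal r p /\ final p = a.

(* The minimum of [f] over [D], and [None] if [D] is empty. *)
Definition min_value (T : finType) (D : pred T) (f : T -> nat) : option nat :=
  omap f [pick x | D x && [forall y, D y ==> (f x <= f y)]].

(* C_(N,k); the default value is never used for k > 0, see [growth_costP]. *)
Definition growth_cost (N k : nat) : nat :=
  odflt 0 (min_value (fun p : N.-tuple 'I_k => legal (@game_rule k) p)
                     (fun p : N.-tuple 'I_k => cost p)).

(* C(a), and [None] if [a] is not reachable.  Each insertion adds one item, so
   all plays that reach [a] have length \sum_i a i. *)
Definition state_cost (k : nat) (r : rule k) (a : state k) : option nat :=
  min_value
    (fun p : (\sum_i a i).-tuple 'I_k => legal r p && (final p == a))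
    (fun p : (\sum_i a i).-tuple 'I_k => cost p).

Lemma min_valueP (T : finType) (D : pred T) (f : T -> nat) (x0 : T) : D x0 ->
  exists x, [/\ D x, min_value D f = Some (f x) & forall y, D y -> f x <= f y].
Proof.
move=> Dx0; rewrite /min_value; case: pickP => [x /andP[Dx /forallP minx]|none].
  by exists x; split=> // y Dy; apply: (implyP (minx y)).
case: (arg_minnP f Dx0) => x Dx minx.
have /negP[] := negbT (none x); rewrite Dx /=.
by apply/forallP=> y; apply/implyP; apply: minx.
Qed.

Lemma ex_game_move (k : nat) (a : state k) : 0 < k -> exists i, game_rule a i.
Proof.
rewrite /game_rule; case: existsP => [[j0 aj0]|_] k_gt0; last first.
  by exists (Ordinal k_gt0).
case: (arg_maxnP (fun j : 'I_k => j : nat) (P := fun j => a j == 0) aj0).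
move=> i ai0 maxi; exists i; rewrite /last_empty ai0 /=.
apply/forallP=> j; apply/implyP=> lt_ij; apply/negP=> aj.
by move: (maxi j aj); rewrite /= leqNgt lt_ij.
Qed.

Lemma ex_game_play (k N : nat) : 0 < k ->
  exists p : N.-tuple 'I_k, legal (@game_rule k) p.
Proof.
move=> k_gt0; rewrite /legal; elim: N (empty_state k) => [|N IHN] a.
  by exists [tuple].
have [i ri] := ex_game_move a k_gt0; have [p lp] := IHN (merge a i).
by exists [tuple of i :: p]; rewrite /= ri.
Qed.

Lemma growth_costP (N k : nat) : 0 < k ->
  exists p : N.-tuple 'I_k,
    [/\ legal (@game_rule k) p, growth_cost N k = cost p &
        forall q : N.-tuple 'I_k, legal (@game_rule k) q -> cost p <= cost q].
Proof.
move=> k_gt0; have [p0 lp0] := ex_game_play N k_gt0.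
have [p [lp e minp]] := min_valueP (D := fun p : N.-tuple 'I_k =>
  legal (@game_rule k) p) (fun p : N.-tuple 'I_k => cost p) lp0.
by exists p; split=> //; rewrite /growth_cost e.
Qed.

(* Main.v *)
(* A merge into A_(i+1) when A_1, ..., A_(i+1) hold M items costs M + 1.  Give a
   subarray A_(i+1) of size m the potential
     sum_(q >= 0) max(0, m - C(q+i, i+1)),
   a convex piecewise linear function of m whose slope is n exactly between
   C(n+i-1, i+1) and C(n+i, i+1).  Tangent lines and Pascal's rule show that a
   merge raises the total potential by at most its cost, with equality if
   A_1, ..., A_(i+1) satisfy the bounds of (iii) for some n.  So every play
   costs at least the potential of its final state, and the same tangent lines
   give the minimum of the potential over states with N items, which is attained
   exactly under the bounds of (iii).
   Conversely a target state is built from its largest nonempty subarray down: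
   to make A_(i+1) of size m, first reach recursively an optimal state of
   A_1, ..., A_(i+1) with m - 1 items, then merge.  Under the rule of the game
   that state must have no empty subarray, so m = 1 or m >= i + 2; optimal
   states obeying this restriction at all levels exist for every N. *)
From Pilot Require (* [path.merge] would otherwise hide the merge of the game. *)
Import Defs.
From mathcomp Require Import all_boot all_order all_algebra.
From mathcomp Require Import zify.
(* [path.merge] would otherwise hide the merge of the game. *)
Import Defs.

Set Implicit Arguments.
Unset Strict Implicit.
Unset Printing Implicit Defensive.

(** * Potential of one subarray and its tangent lines *)

(* The terms with q >= m vanish, see [leq_bin_diag]. *)
Definition block_cost (i m : nat) : nat := \sum_(q < m) (m - 'C(q + i, i.+1)).

Definition balanced (n i m : nat) : bool :=
  'C(n + i, i.+1) <= m <= 'C(n.+1 + i, i.+1).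

Lemma leq_bin_diag q i : q <= 'C(q + i, i.+1).
Proof.
elim: q => // q IHq; rewrite addSn binS; have: 0 < 'C(q + i, i); last by lia.
by rewrite bin_gt0 leq_addl.
Qed.

Lemma leq_bin_diag2 i p q : p <= q -> 'C(p + i, i.+1) <= 'C(q + i, i.+1).
Proof. by move=> le_pq; rewrite leq_bin2l ?leq_add2r. Qed.

Lemma sum_bin_diag n i : \sum_(q < n) 'C(q + i, i.+1) = 'C(n + i, i.+2).
Proof.
elim: n => [|n IHn]; first by rewrite big_ord0 bin_small ?add0n.
by rewrite big_ord_recr /= IHn addSn binS.
Qed.

(** Adds up the intercepts of the tangent lines of slope [n.+1] over [m] levels; the extra [n.+1]
    accounts for the [.+1] in [potential_leqif]. *)
Lemma sum_bin_level n m :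
  n.+1 + \sum_(j < m) 'C(n.+1 + j, j.+2) = 'C(n.+1 + m, m.+1).
Proof.
elim: m => [|m IHm]; first by rewrite big_ord0 !addn0 bin1.
by rewrite big_ord_recr /= addnA IHm addnS binS addnC.
Qed.

Lemma block_cost_widen i m B : m <= B ->
  block_cost i m = \sum_(q < B) (m - 'C(q + i, i.+1)).
Proof.
move=> le_mB; rewrite /block_cost.
rewrite (big_ord_widen _ (fun q => m - 'C(q + i, i.+1)) le_mB).
rewrite big_mkcond; apply: eq_bigr => q _; case: ltnP => // le_mq.
by apply/esym/eqP; rewrite subn_eq0 (leq_trans le_mq) ?leq_bin_diag.
Qed.

(** Termwise: [m <= (m - C) + C] for [q <= n], and later terms are nonnegative. Equality means
    [C <= m] for all [q <= n] and [m <= C] beyond; by monotonicity [q = n] and [q = n.+1] decide. *)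
Lemma block_cost_leqif n i m :
  n.+1 * m <= block_cost i m + 'C(n.+1 + i, i.+2) ?= iff balanced n i m.
Proof.
pose B := n.+2 + m; have nB : n.+1 <= B by lia.
rewrite (@block_cost_widen i m B) ?leq_addl // -sum_bin_diag.
rewrite (big_ord_widen _ (fun q => 'C(q + i, i.+1)) nB) -{1}(card_ord n.+1).
rewrite -sum_nat_const (big_ord_widen _ (fun=> m) nB).
rewrite !(big_mkcond (fun q : 'I_B => _ < _)).
rewrite -big_split /=.
have H (q : 'I_B) : true -> (if q < n.+1 then m else 0) <=
    m - 'C(q + i, i.+1) + (if q < n.+1 then 'C(q + i, i.+1) else 0) ?= iff
    (if q < n.+1 then 'C(q + i, i.+1) <= m else m <= 'C(q + i, i.+1)).
  by move=> _; case: ltnP => _; split; lia.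
have [le_s eq_s] := leqif_sum H; split=> //; rewrite eq_s.
apply/forallP/andP => [all_q|[lo hi] q] /=.
  have [nB' nB''] : n < B /\ n.+1 < B by rewrite /B; lia.
  have := all_q (Ordinal nB'); have := all_q (Ordinal nB'').
  by rewrite /= ltnn ltnSn => -> ->.
case: ltnP => [lt_qn|lt_nq]; first exact: leq_trans (leq_bin_diag2 i (_ : q <= n)) lo.
exact: leq_trans hi (leq_bin_diag2 i lt_nq).
Qed.

Lemma ex_bin_level m M :
  exists n, 'C(n.+1 + m, m.+1) <= M.+1 < 'C(n.+2 + m, m.+1).
Proof.
have ex_n : exists n, M.+1 < 'C(n.+1 + m, m.+1).
  by exists M.+2; have := leq_bin_diag M.+3 m => /ltnW.
case: (ex_minnP ex_n) => -[|n] lt_n min_n; first by rewrite binn in lt_n.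
by exists n; rewrite lt_n andbT leqNgt; apply/negP=> /min_n; rewrite ltnn.
Qed.

(** * Potential of a state and its change in a merge *)

Definition level_sum k m (a : state k) : nat := \sum_(j < k | j < m) a j.

Definition potential k m (a : state k) : nat :=
  \sum_(j < k | j < m) block_cost j (a j).

Definition balanced_below k n m (a : state k) : bool :=
  [forall (j : 'I_k | j < m), balanced n j (a j)].

Lemma potential_leqif k n m (a : state k) : m <= k ->
  n.+1 * (level_sum m a).+1 <= potential m a + 'C(n.+1 + m, m.+1)
    ?= iff balanced_below n m a.
Proof.
move=> le_mk; rewrite -sum_bin_level.
rewrite (big_ord_widen _ (fun j => 'C(n.+1 + j, j.+2)) le_mk).
have H (j : 'I_k) : j < m -> n.+1 * a j <= block_cost j (a j) + 'C(n.+1 + j, j.+2)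
    ?= iff balanced n j (a j) by move=> _; apply: block_cost_leqif.
have := leqif_sum H; rewrite -big_distrr big_split /=.
by rewrite mulnS addnCA /leqif leq_add2l eqn_add2l.
Qed.

Lemma merge_val k (a : state k) (i : 'I_k) : merge a i i = (level_sum i.+1 a).+1.
Proof. by rewrite ffunE ltnn eqxx. Qed.

(** Choose [n] so that the line of slope [n.+2] touches at the new size. It has the same intercept
    as the line of slope [n.+1] for the old state, so subtracting leaves exactly the new size. *)
Lemma block_cost_merge_le k (a : state k) (i : 'I_k) :
  block_cost i (merge a i i) <= potential i.+1 a + merge a i i.
Proof.
rewrite merge_val.
have [n /andP[lo hi]] := ex_bin_level i (level_sum i.+1 a).
have [_ eq1] := block_cost_leqif n.+1 i (level_sum i.+1 a).+1.
have [le2 _] := potential_leqif n a (ltn_ord i).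
move: eq1; rewrite /balanced lo (ltnW hi) => /= /eqP.
by move: le2; rewrite (addSnnS n.+1) (mulSn n.+1); lia.
Qed.

(** The same two lines, with [n] now taken from the old state: equality holds there and the
    inequality is used at the new block. *)
Lemma block_cost_merge_eq k n (a : state k) (i : 'I_k) :
  balanced_below n i.+1 a ->
  block_cost i (merge a i i) = potential i.+1 a + merge a i i.
Proof.
move=> bal; apply/eqP; rewrite eqn_leq block_cost_merge_le merge_val.
have [le1 _] := block_cost_leqif n.+1 i (level_sum i.+1 a).+1.
have [_ eq2] := potential_leqif n a (ltn_ord i).
move: eq2; rewrite bal => /eqP.
by move: le1; rewrite (addSnnS n.+1) (mulSn n.+1); lia.
Qed.

Lemma sum_merge k (f : nat -> nat -> nat) (a : state k) (i : 'I_k) :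
  (forall j, f j 0 = 0) ->
  \sum_(j < k) f j (merge a i j) + \sum_(j < k | j < i.+1) f j (a j) =
  \sum_(j < k) f j (a j) + f i (merge a i i).
Proof.
move=> f0; rewrite (bigID (fun j : 'I_k => j < i.+1)) /=.
rewrite [in RHS](bigID (fun j : 'I_k => j < i.+1)) /=.
rewrite (bigD1 i) //= big1 => [|j /andP[le_ji ne_ji]].
  rewrite (eq_bigr (fun j : 'I_k => f j (a j))); first by lia.
  move=> j; rewrite -leqNgt => lt_ij; rewrite ffunE ltnNge (ltnW lt_ij) /=.
  by case: eqP lt_ij => // ->; rewrite ltnn.
by rewrite ffunE ltn_neqAle ne_ji -ltnS le_ji.
Qed.

Lemma full_level k (F : 'I_k -> nat) : \sum_(j < k | j < k) F j = \sum_j F j.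
Proof. by apply: eq_bigl => j; rewrite ltn_ord. Qed.

Lemma block_cost0 i : block_cost i 0 = 0.
Proof. by rewrite /block_cost big_ord0. Qed.

Lemma level_sum_merge k (a : state k) (i : 'I_k) :
  level_sum k (merge a i) = (level_sum k a).+1.
Proof.
rewrite /level_sum !full_level.
have := sum_merge (f := fun _ m => m) a i (fun _ => erefl).
by rewrite /= merge_val addnS -addSn => /addIn.
Qed.

Lemma potential_merge k (a : state k) (i : 'I_k) :
  potential k (merge a i) + potential i.+1 a =
  potential k a + block_cost i (merge a i i).
Proof. by rewrite /potential !full_level; apply: sum_merge block_cost0. Qed.

Lemma potential_merge_le k (a : state k) (i : 'I_k) :
  potential k (merge a i) <= potential k a + merge a i i.
Proof. by have := potential_merge a i; have := block_cost_merge_le a i; lia. Qed.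

Lemma potential_merge_eq k n (a : state k) (i : 'I_k) :
  balanced_below n i.+1 a ->
  potential k (merge a i) = potential k a + merge a i i.
Proof. by move=> /block_cost_merge_eq; have := potential_merge a i; lia. Qed.

(** * Cost of plays against potential *)

Lemma potential_play_le k (a : state k) (p : seq 'I_k) :
  potential k (foldl (@merge k) a p) <= potential k a + cost_from a p.
Proof.
elim: p a => [|i p IHp] a /=; first by rewrite addn0.
by have := IHp (merge a i); have := potential_merge_le a i; lia.
Qed.

Lemma potential_empty k : potential k (empty_state k) = 0.
Proof. by apply: big1 => j _; rewrite ffunE block_cost0. Qed.

Lemma potential_final_le k (p : seq 'I_k) : potential k (final p) <= cost p.
Proof. by have := potential_play_le (empty_state k) p; rewrite potential_empty. Qed.

Lemma level_sum_final k (p : seq 'I_k) : level_sum k (final p) = size p.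
Proof.
suff H a : level_sum k (foldl (@merge k) a p) = level_sum k a + size p.
  by rewrite H /level_sum big1 // => j _; rewrite ffunE.
elim: p a => [|i p IHp] a /=; first by rewrite addn0.
by rewrite IHp level_sum_merge addSnnS.
Qed.

(** By [potential_play_le] no play costs less than the rise in potential, so a tight play is
    cheapest among all plays from [a] to [b]. *)
Definition tight_play k (r : rule k) (a b : state k) : Prop :=
  exists p, [/\ legal_from r a p, foldl (@merge k) a p = b &
                potential k b = potential k a + cost_from a p].

Lemma tight_refl k (r : rule k) a : tight_play r a a.
Proof. by exists [::]; rewrite addn0. Qed.

Lemma tight_trans k (r : rule k) a b c :
  tight_play r a b -> tight_play r b c -> tight_play r a c.
Proof.
have H p a' q : legal_from r a' p -> legal_from r (foldl (@merge k) a' p) q ->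
    legal_from r a' (p ++ q) /\ cost_from a' (p ++ q) =
      cost_from a' p + cost_from (foldl (@merge k) a' p) q.
  elim: p a' => [|i p IHp] a' //= /andP[-> /IHp{}IHp] /IHp[-> ->].
  by rewrite addnA.
move=> [p [lp fp ep]] [q [lq fq eq]]; exists (p ++ q).
rewrite -fp in lq; have [-> ->] := H _ _ _ lp lq.
by rewrite foldl_cat fp; split=> //; lia.
Qed.

Lemma tight_merge k n (r : rule k) a (i : 'I_k) :
  r a i -> balanced_below n i.+1 a -> tight_play r a (merge a i).
Proof.
move=> ri bal; exists [:: i] => /=.
by rewrite ri (potential_merge_eq bal) addn0.
Qed.

Lemma tight_play_mono k (r r' : rule k) a b :
  (forall c i, r c i -> r' c i) -> tight_play r a b -> tight_play r' a b.
Proof.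
move=> sub [p [lp fp ep]]; exists p; split=> //.
by elim: p a lp {fp ep} => //= i p IHp a /andP[/sub-> /IHp].
Qed.

Lemma game_rule_early k (a : state k) i : game_rule a i -> early_merge_rule a i.
Proof.
rewrite /game_rule; case: existsP => [_ /andP[] //|none _].
apply/forallP=> j; apply/implyP=> _; apply/negP=> aj0.
by apply: none; exists j.
Qed.

(** * Balanced spaced states with a given number of items *)

(* The sizes that A_(i+1) can take under the rule of the game: a merge happens
   only when A_1, ..., A_(i+1) are all nonempty. *)
Definition spaced (i m : nat) : bool := (m <= 1) || (i.+2 <= m).

(* For [n = 1] the bounds are [1 <= x <= m.+2] and [spaced] leaves only the two
   end points, so [x] is chosen greedily there; for [n >= 2] the lower bound
   already implies [spaced]. *)
Lemma ex_top_block n m M :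
  'C(n + m.+1, m.+1) <= M.+1 <= 'C(n.+1 + m.+1, m.+1) ->
  exists x, [/\ x <= M, balanced n m x, spaced m x, x = 0 -> M = 0 &
                'C(n + m, m) <= (M - x).+1 <= 'C(n.+1 + m, m)].
Proof.
rewrite (addnS n) (addnS n.+1) (binS (n + m)) (binS (n.+1 + m)) /balanced /spaced.
have binm1 : 'C(1 + m, m) = m.+1 by exact: binSn.
have binm2 : 'C(2 + m, m.+1) = m.+2 by exact: binSn.
have le_u := leq_bin_diag2 m (leqnSn n).
have le_d : 'C(n + m, m) <= 'C(n.+1 + m, m) by rewrite leq_bin2l // leq_add2r.
case: n le_u le_d => [|[|n]] le_u le_d.
- rewrite binm1 [0 + m]add0n !binn bin_small // => bnd.
  by exists (0 < M); case: M bnd => [|M] bnd; split=> //=; lia.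
- have d_ge : m.*2.+1 <= 'C(2 + m, m).
    elim: m {le_u le_d binm1 binm2} => // m IHm.
    by rewrite (addnS 2) binS [X in X + _](binSn m.+1); lia.
  rewrite binm1 binm2 binn => bnd.
  (* The size [m.+2] leaves enough for the lower levels exactly when [m.*2.+2 <= M]; otherwise
     [d_ge] shows that [1] does not leave too much. *)
  by exists (if m.*2.+2 <= M then m.+2 else 1); case: leqP => H; split; lia.
move=> bnd; have := leq_bin_diag2 m (isT : 2 <= n.+2); rewrite binm2 => l_ge.
have d_gt0 : 0 < 'C(n.+2 + m, m) by rewrite bin_gt0 leq_addl.
(* As large as its own upper bound and the lower bound on the rest permit. *)
exists (minn 'C(n.+3 + m, m.+1) (M.+1 - 'C(n.+2 + m, m))).
by split; lia.
Qed.

(** Splitting off the top size leaves the same hypothesis one level lower; the clause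
    [x = 0 -> M = 0] of [ex_top_block] keeps the empty subarrays a prefix. *)
Lemma ex_balanced_level n m M : 'C(n + m, m) <= M.+1 <= 'C(n.+1 + m, m) ->
  exists c : nat -> nat,
    [/\ \sum_(j < m) c j = M,
        forall j, j < m -> balanced n j (c j) && spaced j (c j) &
        forall i j, i <= j -> j < m -> c j = 0 -> c i = 0].
Proof.
elim: m M => [|m IHm] M.
  by rewrite !bin0 => bnd; exists (fun=> 0); rewrite big_ord0; split=> //; lia.
case/ex_top_block=> x [le_xM bal_x sp_x x0 /IHm[c [sum_c bs_c pre_c]]].
exists (fun j => if j < m then c j else x); split.
- rewrite big_ord_recr /= ltnn (eq_bigr (fun j : 'I_m => c j)).
    by rewrite sum_c subnK.
  by move=> j _; rewrite ltn_ord.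
- move=> j; rewrite ltnS leq_eqVlt => /predU1P[->|lt_jm]; first by rewrite ltnn bal_x.
  by rewrite lt_jm bs_c.
move=> i j le_ij; rewrite ltnS leq_eqVlt => /predU1P[def_j|lt_jm]; last first.
  by rewrite lt_jm (leq_ltn_trans le_ij lt_jm); apply: pre_c.
rewrite def_j ltnn => x_0; have M0 := x0 x_0; case: ltnP => // lt_im.
by move: sum_c; rewrite M0 (bigD1 (Ordinal lt_im)) //=; lia.
Qed.

Definition prefixed_below k m (a : state k) : Prop :=
  forall i j : 'I_k, i <= j -> j < m -> a j = 0 -> a i = 0.

Definition spaced_below k m (a : state k) : Prop :=
  forall j : 'I_k, j < m -> spaced j (a j).

Lemma ex_balanced_state k n m M (b : state k) : m <= k ->
  'C(n + m, m) <= M.+1 <= 'C(n.+1 + m, m) ->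
  exists c : state k,
    [/\ level_sum m c = M, balanced_below n m c, prefixed_below m c,
        spaced_below m c & forall j : 'I_k, m <= j -> c j = b j].
Proof.
move=> le_mk /ex_balanced_level[c [sum_c bs_c pre_c]].
exists [ffun j : 'I_k => if j < m then c j else b j]; split.
- rewrite -sum_c (big_ord_widen _ _ le_mk); apply: eq_bigr => j lt_jm.
  by rewrite ffunE lt_jm.
- by apply/forall_inP=> j lt_jm; rewrite ffunE lt_jm; case/andP: (bs_c j lt_jm).
- move=> i j le_ij lt_jm; rewrite !ffunE lt_jm (leq_ltn_trans le_ij lt_jm).
  exact: pre_c.
- by move=> j lt_jm; rewrite ffunE lt_jm; case/andP: (bs_c j lt_jm).
by move=> j; rewrite ffunE ltnNge => ->.
Qed.

Lemma ex_optimal_level k (i : 'I_k) M (b : state k) :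
  exists n (c : state k),
    [/\ [/\ level_sum i.+1 c = M, balanced_below n i.+1 c,
            prefixed_below i.+1 c & spaced_below i.+1 c],
        forall j : 'I_k, i < j -> c j = b j &
        i < M -> forall j : 'I_k, j <= i -> c j != 0].
Proof.
have [n /andP[lo hi]] := ex_bin_level i M.
have [|c [sum_c bal_c pre_c sp_c eq_c]] := @ex_balanced_state k n i.+1 M b (ltn_ord i).
  by rewrite addnS -addSn lo addnS -addSn ltnW.
exists n, c; split=> // lt_iM j le_ji.
have := forall_inP bal_c j le_ji; rewrite /balanced -lt0n => /andP[lo_j _].
(* Level [0] would force [M <= i]; from level [1] on, all lower bounds are positive. *)
apply: leq_trans lo_j; case: n hi {lo bal_c} => [|n] hi.
  by move: hi; rewrite add2n binSn; lia.
by rewrite bin_gt0; lia.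
Qed.

(** * Building a target state from the top down *)

Lemma level_sumS k (a : state k) (i : 'I_k) :
  level_sum i.+1 a = a i + level_sum i a.
Proof.
rewrite /level_sum (bigD1 i) ?ltnSn //=; congr (_ + _); apply: eq_bigl => j.
by rewrite ltnS [RHS]ltn_neqAle andbC.
Qed.

Lemma level_sum0 k m (a : state k) :
  (forall j : 'I_k, j < m -> a j = 0) -> level_sum m a = 0.
Proof. by move=> a0; apply: big1. Qed.

Lemma level_sum_eq0 k m (a : state k) :
  level_sum m a = 0 -> forall j : 'I_k, j < m -> a j = 0.
Proof.
by move=> sum0 j lt_jm; move: sum0; rewrite /level_sum (bigD1 j) //=; lia.
Qed.

(** An intermediate state of the construction, final from index [m] up. The subarrays there must be
    nonempty for merges below them to be legal. *)
Definition completes k m (b a : state k) : Prop :=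
  (forall j : 'I_k, j < m -> b j = 0) /\
  (forall j : 'I_k, m <= j -> b j != 0 /\ a j = b j).

Lemma completes_eq k m (b a : state k) :
  completes m b a -> level_sum m a = 0 -> a = b.
Proof.
move=> [b0 eq_ab] /level_sum_eq0 a0; apply/ffunP=> j.
by case: (ltnP j m) => [lt_jm|/eq_ab[]//]; rewrite a0 ?b0.
Qed.

Lemma completes_top k (r : rule k) n (i : 'I_k) (b a c : state k) :
  completes i.+1 b a -> a i != 0 ->
  tight_play r b c -> r c i -> balanced_below n i.+1 c ->
  level_sum i.+1 c = (a i).-1 -> (forall j : 'I_k, i < j -> c j = b j) ->
  exists b', tight_play r b b' /\ completes i b' a.
Proof.
move=> [b0 eq_ab] ai tbc rci bal sum_c eq_cb; exists (merge c i); split.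
  exact: tight_trans tbc (tight_merge rci bal).
have mi : merge c i i = a i by rewrite merge_val sum_c prednK ?lt0n.
split=> j; first by rewrite ffunE => ->.
rewrite leq_eqVlt => /predU1P[/val_inj <-|lt_ij]; first by rewrite mi.
have -> : merge c i j = b j.
  rewrite ffunE ltnNge (ltnW lt_ij) /= eq_cb //.
  by case: eqP lt_ij => // ->; rewrite ltnn.
exact: eq_ab.
Qed.

Lemma prefixed_top k (a : state k) (i : 'I_k) :
  prefixed_below i.+1 a -> level_sum i.+1 a != 0 -> a i != 0.
Proof.
move=> pre; apply: contraNneq => ai0; apply/eqP; apply: level_sum0 => j lt_ji.
exact: pre ai0.
Qed.

(** Strong induction on the number of items below [m]: before the merge into [A_(i+1)], a state [c]
    with [(a i).-1] items has to be built on the same levels. *)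
Lemma game_tight k m (b a : state k) : m <= k -> completes m b a ->
  prefixed_below m a -> spaced_below m a -> tight_play (@game_rule k) b a.
Proof.
have [T le_T] := ubnP (level_sum m a); elim: T => // T IHT in m b a le_T *.
move=> le_mk comp pre sp; have [sum0|sum_gt0] := eqVneq (level_sum m a) 0.
  by rewrite (completes_eq comp sum0); apply: tight_refl.
case: m => [|m] in le_T le_mk comp pre sp sum_gt0 *.
  by rewrite level_sum0 in sum_gt0.
pose i := Ordinal le_mk; rewrite -[m]/(val i) in le_T comp pre sp sum_gt0 *.
have ai := prefixed_top pre sum_gt0.
have [b' [tbb' comp']] :
    exists b', tight_play (@game_rule k) b b' /\ completes i b' a.
  (* For size [1], [b] is empty up to [i], so the rule forces this insertion, and [b] is balanced
     there at level [0]. *)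
  have [ai1|ai_gt1] := leqP (a i) 1.
    apply: (@completes_top _ _ 0 i _ _ b) => //; first exact: tight_refl.
    - rewrite /game_rule; case: existsP => // _; case: comp => b0 eq_ab.
      rewrite /last_empty b0 ?ltnSn //=.
      by apply/forall_inP=> j /eq_ab[].
    - apply/forall_inP=> j lt_ji; case: comp => -> // _.
      by rewrite /balanced bin_small.
    - by rewrite level_sum0; [lia | case: comp].
  (* Spacing gives [c] at least [i.+1] items, so it has no empty subarray and the merge is a free
     choice. *)
  have lt_i : i < (a i).-1 by have := sp i (ltnSn i); rewrite /spaced; lia.
  have [n [c [[sum_c bal_c pre_c sp_c] eq_cb c_neq0]]] := ex_optimal_level i (a i).-1 b.
  apply: (@completes_top _ _ n i _ _ c) => //.
    apply: (IHT i.+1) => //.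
      by move: le_T; rewrite sum_c level_sumS; lia.
    case: comp => b0 eq_ab; split=> // j lt_ij.
      by rewrite eq_cb //; case: (eq_ab j lt_ij).
  rewrite /game_rule; case: existsP => // -[j /eqP cj0].
  case: (leqP j i) => [/(c_neq0 lt_i)|lt_ij]; first by rewrite cj0.
  by case: comp => _ /(_ j lt_ij)[]; rewrite -eq_cb // cj0.
apply: tight_trans tbb' _; apply: (IHT i) => //.
- by move: le_T; rewrite level_sumS; lia.
- by apply: ltnW.
- by move=> j1 j2 le12 lt2; apply: pre => //; apply: ltnW.
by move=> j lt_ji; apply: sp; apply: ltnW.
Qed.

(** An early merge accepts any optimal [c], even with empty subarrays. Such a [c] comes from
    [game_tight], so the induction only handles the levels below [i]. *)
Lemma early_tight k m (b a : state k) : m <= k -> completes m b a ->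
  prefixed_below m a -> tight_play (@early_merge_rule k) b a.
Proof.
elim: m b => [|m IHm] b le_mk comp pre.
  by rewrite (completes_eq comp) ?level_sum0 //; apply: tight_refl.
have [sum0|sum_gt0] := eqVneq (level_sum m.+1 a) 0.
  by rewrite (completes_eq comp sum0); apply: tight_refl.
pose i := Ordinal le_mk; rewrite -[m]/(val i) in comp pre sum_gt0.
have ai := prefixed_top pre sum_gt0.
have [n [c [[sum_c bal_c pre_c sp_c] eq_cb c_neq0]]] := ex_optimal_level i (a i).-1 b.
have [b' [tbb' comp']] :
    exists b', tight_play (@early_merge_rule k) b b' /\ completes i b' a.
  apply: (@completes_top _ _ n i _ _ c) => //.
    apply: tight_play_mono (@game_rule_early k) _; apply: (@game_tight k i.+1) => //.
    case: comp => b0 eq_ab; split=> // j lt_ij.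
      by rewrite eq_cb //; case: (eq_ab j lt_ij).
  apply/forall_inP=> j lt_ij; rewrite eq_cb //.
  by case: comp => _ /(_ j lt_ij)[].
apply: tight_trans tbb' _; apply: IHm => //; first exact: ltnW.
by move=> j1 j2 le12 lt2; apply: pre => //; apply: ltnW.
Qed.

(** * Minimum costs and reachable states *)

Lemma completes_empty k (a : state k) : completes k (empty_state k) a.
Proof.
by split=> j; rewrite ?ffunE // leqNgt ltn_ord.
Qed.

Lemma tight_state_cost k (r : rule k) (a : state k) :
  tight_play r (empty_state k) a -> state_cost r a = Some (potential k a).
Proof.
move=> [p [lp fp ep]]; have sz : size p == \sum_i a i.
  by rewrite -(level_sum_final p) /level_sum full_level /final fp.
rewrite /state_cost; have [|q [/andP[_ /eqP fq] -> min_q]] :=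
  min_valueP (D := fun q : (\sum_i a i).-tuple 'I_k => legal r q && (final q == a))
    (fun q : (\sum_i a i).-tuple 'I_k => cost q) (x0 := Tuple sz).
  by rewrite /legal /final lp fp eqxx.
have := potential_final_le q; rewrite fq => ge_q.
congr Some; apply/eqP; rewrite eqn_leq ge_q andbT.
have := min_q (Tuple sz); rewrite /legal /final lp fp eqxx => /(_ isT).
by rewrite ep potential_empty.
Qed.

(** The line of slope [n.+1] bounds the final potential of every play from below, and a tight play
    to a balanced spaced state attains it. Both bounds on [N] are closed, so adjacent levels share
    an endpoint. *)
Lemma growth_cost_eq k N n : 0 < k ->
  'C(n + k, k) <= N.+1 <= 'C(n.+1 + k, k) ->
  growth_cost N k + 'C(n.+1 + k, k.+1) = n.+1 * N.+1.
Proof.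
move=> k_gt0 bnd; have [p [lp -> min_p]] := growth_costP N k_gt0.
have [a [sum_a bal_a pre_a sp_a _]] := ex_balanced_state (empty_state k) (leqnn k) bnd.
have [q [lq fq eq]] := game_tight (leqnn k) (completes_empty a) pre_a sp_a.
have sz : size q == N by rewrite -(level_sum_final q) /final fq sum_a.
have le_pq : cost p <= cost q by apply: (min_p (Tuple sz)).
have [_ eq_a] := potential_leqif n a (leqnn k).
move: eq_a; rewrite bal_a sum_a => /eqP eq_a.
have [le_p _] := potential_leqif n (final p) (leqnn k).
rewrite level_sum_final size_tuple in le_p.
have := potential_final_le p; move: eq; rewrite potential_empty -/(cost q); lia.
Qed.

(** An invariant, kept together with the prefix property: a forced insertion finds only empty
    subarrays below and makes size [1]; a free merge joins [i.+1] nonempty subarrays and the new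
    item. *)
Lemma spaced_reachable k (a : state k) :
  reachable (@game_rule k) a -> spaced_below k a.
Proof.
move=> [p [lp <-]]; rewrite /final.
suff H b : spaced_below k b -> prefixed_below k b -> legal_from (@game_rule k) b p ->
    spaced_below k (foldl (@merge k) b p).
  apply: H lp; last by move=> i j _ _ _; rewrite ffunE.
  by move=> j _; rewrite ffunE.
elim: p b {lp} => //= i p IHp b sp pre /andP[ri lp]; apply: IHp lp => [j _|j l le_jl _].
  have [->|ne_ji] := eqVneq j i; last first.
    by rewrite ffunE (negPf ne_ji); case: ifP => // _; apply: sp.
  rewrite merge_val; move: ri; rewrite /game_rule.
  case: existsP => [_ /andP[/eqP bi0 _]|none _].
    by rewrite level_sum0 // => j' le_j'i; apply: pre bi0.
  rewrite /spaced !ltnS; apply/orP; right.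
  have := card_ord i.+1; rewrite -sum1_card.
  rewrite (big_ord_widen _ (fun=> 1) (ltn_ord i)) => {1}<-.
  apply: leq_sum => j' _; rewrite lt0n; apply/negP=> bj0.
  by apply: none; exists j'.
rewrite !ffunE; case: (ltngtP l i) => [lt_li|lt_il|/val_inj ->]; rewrite ?eqxx //.
  by rewrite (leq_ltn_trans le_jl lt_li).
have -> : (l == i) = false by apply/eqP=> eq_li; rewrite eq_li ltnn in lt_il.
move=> bl0; exfalso; move: ri; rewrite /game_rule.
case: existsP => [_ /andP[_ /forallP/(_ l)]|none _]; first by rewrite lt_il bl0.
by apply: none; exists l; rewrite bl0.
Qed.

Lemma in_P_prefixed k N (a : state k) : in_P N a -> prefixed_below k a.
Proof.
move=> [_ pre] i j le_ij _ aj0.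
suff H d (l : 'I_k) : l + d = j -> a l = 0 by apply: (H (j - i)); rewrite subnKC.
elim: d l => [|d IHd] l eq_l.
  by rewrite (_ : l = j) //; apply: val_inj; rewrite /= -eq_l addn0.
have lt_lk : l.+1 < k by apply: leq_ltn_trans (ltn_ord j); rewrite -eq_l; lia.
by apply: (pre l (Ordinal lt_lk)) => //; apply: IHd; rewrite /= addSnnS.
Qed.

Lemma growth_cost_state k n N (a : state k) : 0 < k -> in_P N a ->
  'C(n + k, k) <= N.+1 <= 'C(n.+1 + k, k) ->
  Some (growth_cost N k) = Some (potential k a) <->
  forall i : 'I_k, balanced n i (a i).
Proof.
move=> k_gt0 [sum_a _] /(growth_cost_eq k_gt0) eq_g.
have [_] := potential_leqif n a (leqnn k).
rewrite /level_sum full_level sum_a -eq_g eqn_add2r => eq_a.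
split=> [[eq_p] i|bal].
  by move: eq_a; rewrite eq_p eqxx => /esym/forall_inP; apply; apply: ltn_ord.
congr Some; apply/eqP; rewrite eq_a; apply/forall_inP=> i _; exact: bal.
Qed.

Theorem theorem8p6 (k N : nat) (hk : 1 <= k) :
  (* (i) *)
  (forall n : nat,
     ('C(n + k - 1, k)%:Z - 1 <= N%:Z <= 'C(n + k, k)%:Z - 1)%R ->
     ((growth_cost N k)%:Z = (N%:Z + 1) * n%:Z - 'C(n + k, k + 1)%:Z)%R)
  /\
  (* (ii) *)
  (forall n : nat, 1 <= n ->
     'C(n + k - 1, k) <= N < 'C(n + k, k) ->
     ((growth_cost N k)%:Z - (growth_cost (N - 1) k)%:Z = n%:Z)%R)
  /\
  (* (iii) *)
  (forall (n : nat) (a : state k),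
     ('C(n + k - 1, k)%:Z - 1 <= N%:Z < 'C(n + k, k)%:Z - 1)%R ->
     in_P N a ->
     (reachable (@game_rule k) a ->
        (Some (growth_cost N k) = state_cost (@game_rule k) a <->
         forall i : 'I_k,
           'C(n + i.+1 - 2, i.+1) <= a i <= 'C(n + i.+1 - 1, i.+1)))
     /\
     (Some (growth_cost N k) = state_cost (@early_merge_rule k) a <->
      forall i : 'I_k,
        'C(n + i.+1 - 2, i.+1) <= a i <= 'C(n + i.+1 - 1, i.+1))).
Proof.
have predE n : n.+1 + k - 1 = n + k by lia.
split; [|split].
- case=> [|n] bnd.
    (* For [n = 0] only [N = 0] remains, which also belongs to the level of slope [1]. *)
    have N0 : N = 0 by move: bnd; rewrite add0n binn; lia.
    have := @growth_cost_eq k 0 0 hk; rewrite N0 !add0n binn bin_gt0 leq_addl.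
    by move=> /(_ isT); rewrite addn1 binn bin_small //; lia.
  rewrite predE in bnd; rewrite addn1.
  by have := @growth_cost_eq k N n hk; lia.
- case=> // n _; rewrite predE => bnd.
  have C_gt0 : 0 < 'C(n + k, k) by rewrite bin_gt0 leq_addl.
  (* Both [N - 1] and [N] lie in the closed range of this level, so the costs differ by its slope
     [n.+1]. *)
  have := @growth_cost_eq k N n hk; have := @growth_cost_eq k (N - 1) n hk.
  rewrite (_ : (N - 1).+1 = N); last by lia.
  by rewrite mulnS; lia.
case=> [|n] a bnd Pa.
  (* The range for [N] is empty when [n = 0]. *)
  by move: bnd; rewrite add0n binn; lia.
rewrite predE in bnd.
have bndE : (forall i : 'I_k, balanced n i (a i)) <-> forall i : 'I_k,
    'C(n.+1 + i.+1 - 2, i.+1) <= a i <= 'C(n.+1 + i.+1 - 1, i.+1).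
  have [e2 e1] : (forall i, n.+1 + i.+1 - 2 = n + i) /\
      (forall i, n.+1 + i.+1 - 1 = n.+1 + i) by split; lia.
  by split=> H i; move: (H i); rewrite e1 e2.
have pre := in_P_prefixed Pa.
have opt : Some (growth_cost N k) = Some (potential k a) <->
    forall i : 'I_k, balanced n i (a i) by apply: growth_cost_state hk Pa _; lia.
rewrite -bndE; split=> [/spaced_reachable sp|].
  by rewrite (tight_state_cost (game_tight (leqnn k) (completes_empty a) pre sp)).
by rewrite (tight_state_cost (early_tight (leqnn k) (completes_empty a) pre)).
Qed.
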